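(* Let $H$ be an infinite discrete group and let $G=H^{\mathbb N}$ with the discrete topology. For $A\subseteq\mathbb N$ let $G_A=H^A\times(H^{\mathbb N\setminus A})^{ap}$, let $\eta_A:G\to G_A$, $\eta_A(x)=(\pi_A(x),\eta^{\mathbb N\setminus A}_{ap}(\pi_{\mathbb N\setminus A}(x)))$, and let $\tau_A=\{\eta_A^{-1}(V):V\text{ open in }G_A\}\in\mathcal T(G)$. 1. The map $\mathcal P(\mathbb N)\to\mathcal T(G):A\mapsto\tau_A$ is injective and $\tau_{A\cup B}=\tau_A\vee\tau_B$ for all $A,B\subseteq\mathbb N$ (i.e., $A\mapsto\tau_A$ is an upper semilattice monomorphism). 2. For $A\subseteq B\subseteq\mathbb N$, $\tau_A\subseteq\tau_B$ and the canonical intertwining map $\eta^B_A:=\eta^{\tau_B}_{\tau_A}:G_B\to G_A$ factors as $$\eta^B_A=(\mathrm{id}_A\times\kappa_{A,B})\circ(\mathrm{id}_A\times\eta^{B\setminus A}_{ap}\times\mathrm{id})\circ(\phi_{A,B\setminus A}\times\mathrm{id}),$$ where the successive maps are $\phi_{A,B\setminus A}\times\mathrm{id}:H^B\times(H^{\mathbb N\setminus B})^{ap}\to H^A\times H^{B\setminus A}\times(H^{\mathbb N\setminus B})^{ap}$ (a topological group isomorphism), $\mathrm{id}_A\times\eta^{B\setminus A}_{ap}\times\mathrm{id}: H^A\times H^{B\setminus A}\times(H^{\mathbb N\setminus B})^{ap}\to H^A\times (H^{B\setminus A})^{ap}\times(H^{\mathbb N\setminus B})^{ap}$, and $\mathrm{id}_A\times\kappa_{A,B}:H^A\times(H^{B\setminus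 A})^{ap}\times(H^{\mathbb N\setminus B})^{ap}\to H^A\times(H^{\mathbb N\setminus A})^{ap}$ (a topological group isomorphism). 3. The set $\mathcal B=\{\tau_A:A\subseteq\mathbb N\}$ is a disjoint subsemilattice of $(\mathcal T(G),\vee)$.
   Context: Locally compact groups are Hausdorff; $A(G)$ and $B(G)$ are the Fourier and Fourier–Stieltjes algebras of $G$. A topology $\tau$ on $G$ is locally precompact if there are a locally compact group $G_\tau$ and a continuous homomorphism $\eta_\tau:G\to G_\tau$ with dense range such that $\tau=\{\eta_\tau^{-1}(V):V\text{ open in }G_\tau\}$; $(G_\tau,\eta_\tau)$, unique up to intertwining topological group isomorphism, is a representation of $\tau$. $\mathcal T(G)$ is the set of locally precompact topologies on $G$, a join semilattice under the join $\vee$ taken in the lattice of topologies on $G$. $A_\tau(G)=\{v\circ\eta_\tau:v\in A(G_\tau)\}\subseteq B(G)$. For $\sigma\subseteq\tau$ in $\mathcal T(G)$, $\eta^\tau_\sigma:G_\tau\to G_\sigma$ is the unique continuous homomorphism with $\eta^\tau_\sigma\circ\eta_\tau=\eta_\sigma$. A set $\mathcal B\subseteq\mathcal T(G)$ is disjoint if $A_\sigma(G)\cap A_\tau(G)=\{0\}$ for $\sigma\ne\tau$ in $\mathcal B$. For a locally compact group $L$, $(L^{ap},\eta^L_{ap})$ is its almost periodic (Bohr) compactification: the maximum (universal) compact topological group $L^{ap}$ with continuous dense-range homomorphism $\eta^L_{ap}:L\to L^{ap}$. For $A\subseteq\mathbb N$, $H^A$ has the discrete topology and $\eta^A_{ap}:=\eta^{H^A}_{ap}$.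 For $A\subseteq B\subseteq\mathbb N$, $\pi_A:H^B\to H^A:(x_i)_{i\in B}\mapsto(x_i)_{i\in A}$. For disjoint $A,B\subseteq\mathbb N$, $\lambda_{A,B}:H^A\times H^B\to H^{A\cup B}$ is the map $((x_i)_{i\in A},(x_i)_{i\in B})\mapsto(x_i)_{i\in A\cup B}$ and $\phi_{A,B}:H^{A\cup B}\to H^A\times H^B:x\mapsto(\pi_A(x),\pi_B(x))$. The pair $(G_A,\eta_A)$ is a representation of $\tau_A$ and is the one used in the statement. For $A\subseteq B\subseteq\mathbb N$, $\kappa_{A,B}:(H^{B\setminus A})^{ap}\times(H^{\mathbb N\setminus B})^{ap}\to(H^{\mathbb N\setminus A})^{ap}$ is the topological group isomorphism $\kappa_{A,B}=\widetilde\lambda_{B\setminus A,\mathbb N\setminus B}\circ\psi$, where $\psi:(H^{B\setminus A})^{ap}\times(H^{\mathbb N\setminus B})^{ap}\to(H^{B\setminus A}\times H^{\mathbb N\setminus B})^{ap}$ is the canonical isomorphism of compactifications of $H^{B\setminus A}\times H^{\mathbb N\setminus B}$ and $\widetilde\lambda_{B\setminus A,\mathbb N\setminus B}:(H^{B\setminus A}\times H^{\mathbb N\setminus B})^{ap}\to(H^{\mathbb N\setminus A})^{ap}$ is the isomorphism induced by $\lambda_{B\setminus A,\mathbb N\setminus B}$ (intertwining the compactification maps). Thus $\kappa_{A,B}\circ(\eta^{B\setminus A}_{ap}\times\eta^{\mathbb N\setminus B}_{ap})=\eta^{\mathbb N\setminus A}_{ap}\circ\lambda_{B\setminus A,\mathbb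 N\setminus B}$. *)

(* Defs.v *)
From HB Require Import structures.
From mathcomp Require Import all_boot all_order all_algebra.
From mathcomp Require Import all_classical all_reals all_analysis.
From mathcomp Require Import sesquilinear.
From mathcomp Require Import complex.

Set Implicit Arguments.
Unset Strict Implicit.
Unset Printing Implicit Defensive.

Import Order.TTheory GRing.Theory Num.Theory.
Import numFieldNormedType.Exports.

Local Open Scope classical_set_scope.
Local Open Scope group_scope.

(** * Topological groups *)

HB.mixin Record isTopGroup G & Group G & Topological G := {
  mulg_continuous : continuous (fun xy : G * G => xy.1 * xy.2);
  invg_continuous : continuous (fun x : G => x^-1)
}.

#[short(type="topGroupType")]
HB.structure Definition TopGroup :=
  { G of Group G & Topological G & isTopGroup G }.

Section ProductGroup.
Variables G H : topGroupType.

Lemma prod_mulg_continuous :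
  continuous (fun xy : (G * H) * (G * H) => xy.1 * xy.2).
Proof.
move=> z.
have cG : xy.1.1 * xy.2.1 @[xy --> z] --> z.1.1 * z.2.1.
  apply: (@cvg_comp _ _ _ (fun xy : (G * H) * (G * H) => (xy.1.1, xy.2.1))
    (fun xy : G * G => xy.1 * xy.2) _ (nbhs (z.1.1, z.2.1)));
    last exact: (@mulg_continuous G (z.1.1, z.2.1)).
  apply: cvg_pair.
  - by apply: (@cvg_comp _ _ _ fst fst); [exact: cvg_fst | exact: cvg_fst].
  - by apply: (@cvg_comp _ _ _ snd fst); [exact: cvg_snd | exact: cvg_fst].
have cH : xy.1.2 * xy.2.2 @[xy --> z] --> z.1.2 * z.2.2.
  apply: (@cvg_comp _ _ _ (fun xy : (G * H) * (G * H) => (xy.1.2, xy.2.2))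
    (fun xy : H * H => xy.1 * xy.2) _ (nbhs (z.1.2, z.2.2)));
    last exact: (@mulg_continuous H (z.1.2, z.2.2)).
  apply: cvg_pair.
  - by apply: (@cvg_comp _ _ _ fst snd); [exact: cvg_fst | exact: cvg_snd].
  - by apply: (@cvg_comp _ _ _ snd snd); [exact: cvg_snd | exact: cvg_snd].
exact: (cvg_pair cG cH).
Qed.

Lemma prod_invg_continuous : continuous (fun x : G * H => x^-1).
Proof.
move=> z.
have cG : x.1^-1 @[x --> z] --> z.1^-1.
  apply: (@cvg_comp _ _ _ fst (fun x : G => x^-1)); first exact: cvg_fst.
  exact: invg_continuous.
have cH : x.2^-1 @[x --> z] --> z.2^-1.
  apply: (@cvg_comp _ _ _ snd (fun x : H => x^-1)); first exact: cvg_snd.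
  exact: invg_continuous.
exact: (cvg_pair cG cH).
Qed.

HB.instance Definition _ :=
  isTopGroup.Build (G * H)%type prod_mulg_continuous prod_invg_continuous.

End ProductGroup.

Definition cont_hom (G H : topGroupType) (f : G -> H) : Prop :=
  continuous f /\ {morph f : x y / x * y}.

Definition topgroup_iso (G H : topGroupType) (f : G -> H) : Prop :=
  cont_hom f /\
  exists g : H -> G, [/\ cont_hom g, cancel f g & cancel g f].

Definition lc_group (G : topGroupType) : Prop :=
  hausdorff_space G /\ locally_compact [set: G].

Definition compact_group (G : topGroupType) : Prop :=
  hausdorff_space G /\ compact [set: G].

Definition intertwines (G L M : topGroupType) (eta : G -> L) (eta' : G -> M)
    (f : L -> M) : Prop :=
  cont_hom f /\ f \o eta = eta'.

(* When [eta] has dense range and [M] is Hausdorff there is at most one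
   intertwining map; the trivial homomorphism is a dummy value for the case
   where there is none. *)
Definition intertwiner (G L M : topGroupType) (eta : G -> L) (eta' : G -> M) :
    L -> M :=
  xget (fun=> 1) [set f | intertwines eta eta' f].

Definition pair_map (S T U V : Type) (f : S -> U) (g : T -> V) (x : S * T) :
    U * V :=
  (f x.1, g x.2).

Definition pair_assoc (S T U : Type) (x : (S * T) * U) : S * (T * U) :=
  (x.1.1, (x.1.2, x.2)).

(** * Almost periodic (Bohr) compactifications *)

Record bohr (L : topGroupType) := Bohr {
  bohr_group :> topGroupType;
  bohr_map : L -> bohr_group;
  bohr_compact : compact_group bohr_group;
  bohr_hom : cont_hom bohr_map;
  bohr_dense : dense (range bohr_map);
  bohr_universal : forall (K : topGroupType) (f : L -> K),
    compact_group K -> cont_hom f ->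
    exists g : bohr_group -> K, intertwines bohr_map f g
}.

(** * Fourier-Stieltjes and Fourier algebras *)

Section FourierAlgebra.
Local Open Scope ring_scope.
Variable R : realType.

Record hilbert := Hilbert {
  hilbert_space :> completeNormedModType R[i];
  (* linear in the first variable *)
  hilbert_ip : {dot hilbert_space for (@Num.conj_op R[i])};
  hilbert_normE : forall x : hilbert_space, `|x| ^+ 2 = hilbert_ip x x
}.

Definition unitary_rep (L : topGroupType) (V : hilbert) (pi : L -> V -> V) :
    Prop :=
  [/\ pi 1%g = id,
      forall x y, pi (x * y)%g = pi x \o pi y,
      forall x, linear (pi x),
      forall x v w, hilbert_ip V (pi x v) (pi x w) = hilbert_ip V v w &
      forall v, continuous (fun x => pi x v)].

(* The possible factors |xi| |eta| when u = < pi(.) xi | eta >. *)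
Definition coefficient_bounds (L : topGroupType) (u : L -> R[i]) : set R :=
  [set r | exists (V : hilbert) (pi : L -> V -> V) (xi eta : V),
    [/\ unitary_rep pi,
        forall x, u x = hilbert_ip V (pi x xi) eta &
        r%:C%C = `|xi| * `|eta|]].

Definition fourier_stieltjes (L : topGroupType) : set (L -> R[i]) :=
  [set u | coefficient_bounds u !=set0].

(* The norm of B(L) is the infimum of |xi| |eta| over all realizations of u as
   a coefficient; it takes the value +oo outside of B(L). *)
Definition fs_norm (L : topGroupType) (u : L -> R[i]) : \bar R :=
  ereal_inf [set r%:E | r in coefficient_bounds u].

Definition compact_support (L : topGroupType) (u : L -> R[i]) : Prop :=
  compact (closure [set x | u x != 0]).

(* Eymard's definition of A(L) as the closure of B(L) `&` C_c(L) in B(L). *)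
Definition fourier (L : topGroupType) : set (L -> R[i]) :=
  [set u | fourier_stieltjes u /\
    forall e : R, 0 < e -> exists v : L -> R[i],
      [/\ fourier_stieltjes v, compact_support v &
          (fs_norm (fun x => (u x - v x)%R) < e%:E)%E]].

End FourierAlgebra.

(** * Locally precompact topologies *)

Section LocallyPrecompact.
Variable G : topGroupType.
Implicit Types sigma tau : set (set G).

Definition induced_topology (L : topGroupType) (eta : G -> L) : set (set G) :=
  [set eta @^-1` V | V in open].

Definition representation (L : topGroupType) (eta : G -> L) tau : Prop :=
  [/\ lc_group L, cont_hom eta, dense (range eta) &
      tau = induced_topology eta].

Definition locally_precompact : set (set (set G)) :=
  [set tau | exists (L : topGroupType) (eta : G -> L), representation eta tau].

Definition is_topology tau : Prop :=
  [/\ tau setT,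
      forall U V, tau U -> tau V -> tau (U `&` V) &
      forall C : set (set G), C `<=` tau -> tau (\bigcup_(U in C) U)].

Definition topology_join sigma tau : set (set G) :=
  \bigcap_(rho in [set rho | is_topology rho /\ sigma `|` tau `<=` rho]) rho.

(* A representation of [tau] is unique up to an intertwining isomorphism, so
   that the functions obtained do not depend on it. *)
Definition fourier_of_topology (R : realType) tau : set (G -> R[i]) :=
  [set u | exists (L : topGroupType) (eta : G -> L) (v : L -> R[i]),
    [/\ representation eta tau, fourier v & u = v \o eta]].

Definition disjoint_topologies (R : realType) (B : set (set (set G))) : Prop :=
  forall sigma tau, B sigma -> B tau -> sigma <> tau ->
    fourier_of_topology (R := R) sigma `&` fourier_of_topology tau
      = [set (fun=> 0%R)].

Definition subsemilattice (B : set (set (set G))) : Prop :=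
  B `<=` locally_precompact /\
  forall sigma tau, B sigma -> B tau -> B (topology_join sigma tau).

End LocallyPrecompact.

(** * Powers of a group *)

Definition hpow (H : groupType) (A : set nat) : Type := A -> H.

Section Power.
Variables (H : groupType) (A : set nat).
Implicit Types x y z : hpow H A.

HB.instance Definition _ := Choice.copy (hpow H A) (A -> H).

Definition hpow_one : hpow H A := fun=> 1.
Definition hpow_inv x : hpow H A := fun i => (x i)^-1.
Definition hpow_mul x y : hpow H A := fun i => x i * y i.

Fact hpow_mulA : associative hpow_mul.
Proof. by move=> x y z; apply/funext => i; rewrite /hpow_mul mulgA. Qed.
Fact hpow_mul1 : left_id hpow_one hpow_mul.
Proof. by move=> x; apply/funext => i; rewrite /hpow_mul mul1g. Qed.
Fact hpow_mulr1 : right_id hpow_one hpow_mul.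
Proof. by move=> x; apply/funext => i; rewrite /hpow_mul mulg1. Qed.
Fact hpow_mulV : left_inverse hpow_one hpow_inv hpow_mul.
Proof. by move=> x; apply/funext => i; rewrite /hpow_mul mulVg. Qed.
Fact hpow_mulrV : right_inverse hpow_one hpow_inv hpow_mul.
Proof. by move=> x; apply/funext => i; rewrite /hpow_mul mulgV. Qed.

HB.instance Definition _ := isGroup.Build (hpow H A)
  hpow_mulA hpow_mul1 hpow_mulr1 hpow_mulV hpow_mulrV.

(* discrete topology, also for infinite [A] *)
HB.instance Definition _ := hasNbhs.Build (hpow H A) principal_filter.
HB.instance Definition _ := Discrete_ofNbhs.Build (hpow H A) erefl.

Fact hpow_mulg_continuous :
  continuous (fun xy : hpow H A * hpow H A => xy.1 * xy.2).
Proof.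
move=> [x y] U /principal_filterP Uxy.
exists ([set x], [set y]) => /=.
  by split; apply/principal_filterP.
by move=> [a b] [/= -> ->].
Qed.
Fact hpow_invg_continuous : continuous (fun x : hpow H A => x^-1).
Proof. by move=> x U /principal_filterP Ux; apply/principal_filterP. Qed.

HB.instance Definition _ :=
  isTopGroup.Build (hpow H A) hpow_mulg_continuous hpow_invg_continuous.

End Power.

Section PowerMaps.
Variable H : groupType.

Definition hproj (A B : set nat) (sAB : A `<=` B) (x : hpow H B) : hpow H A :=
  fun i : A => x (exist _ (\val i) (mem_set (sAB _ (set_mem (valP i))))).

(* phi_{A,B}, with [C] in the role of the union of [A] and [B] *)
Definition hsplit (A B C : set nat) (sAC : A `<=` C) (sBC : B `<=` C)
    (x : hpow H C) : hpow H A * hpow H B :=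
  (hproj sAC x, hproj sBC x).

(* lambda_{A,B}, with [C] in the role of the union of [A] and [B] *)
Definition hglue (A B C : set nat) (sC : C `<=` A `|` B)
    (x : hpow H A * hpow H B) : hpow H C :=
  fun i : C =>
    match pselect (A (\val i)) with
    | left Ai => x.1 (exist _ (\val i) (mem_set Ai))
    | right nAi => x.2 (exist _ (\val i)
        (mem_set (or_ind (fun Ai => False_ind _ (nAi Ai)) id
                         (sC _ (set_mem (valP i))))))
    end.

End PowerMaps.

Lemma setC_split (A B : set nat) : ~` A `<=` (B `\` A) `|` ~` B.
Proof. by move=> n nA; have [Bn|nBn] := pselect (B n); [left|right]. Qed.

(** * The topologies tau_A on H^N *)

Section TauA.
Variables (H : groupType) (ap : forall L : topGroupType, bohr L).

Definition hpow_ap (A : set nat) : topGroupType := ap (hpow H A).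
Definition eta_ap (A : set nat) : hpow H A -> hpow_ap A :=
  bohr_map (ap (hpow H A)).

Definition GA (A : set nat) : topGroupType :=
  (hpow H A * hpow_ap (~` A))%type.

Definition etaA (A : set nat) (x : hpow H [set: nat]) : GA A :=
  (hproj (@subsetT _ A) x, eta_ap (hproj (@subsetT _ (~` A)) x)).

Definition tauA (A : set nat) : set (set (hpow H [set: nat])) :=
  induced_topology (@etaA A).

Section Kappa.
Variables A B : set nat.

Definition kappa_psi : hpow_ap (B `\` A) * hpow_ap (~` B) ->
    ap (hpow H (B `\` A) * hpow H (~` B))%type :=
  intertwiner (pair_map (@eta_ap (B `\` A)) (@eta_ap (~` B)))
              (bohr_map (ap (hpow H (B `\` A) * hpow H (~` B))%type)).

Definition kappa_lambda :
    ap (hpow H (B `\` A) * hpow H (~` B))%type -> hpow_ap (~` A) :=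
  intertwiner (bohr_map (ap (hpow H (B `\` A) * hpow H (~` B))%type))
              (@eta_ap (~` A) \o hglue (@setC_split A B)).

Definition kappa : hpow_ap (B `\` A) * hpow_ap (~` B) -> hpow_ap (~` A) :=
  kappa_lambda \o kappa_psi.

End Kappa.

(* eta^B_A *)
Definition connecting (A B : set nat) : GA B -> GA A :=
  intertwiner (@etaA B) (@etaA A).

End TauA.

Arguments hpow_ap H ap A : clear implicits.
Arguments eta_ap H ap A : clear implicits.
Arguments GA H ap A : clear implicits.
Arguments etaA H ap A : clear implicits.
Arguments tauA H ap A : clear implicits.
Arguments kappa H ap A B : clear implicits.
Arguments connecting H ap A B : clear implicits.

(* Main.v *)
Require Import Defs.
From HB Require Import structures.
From mathcomp Require Import all_boot all_order all_algebra.
From mathcomp Require Import all_classical all_reals all_analysis.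
From mathcomp Require Import sesquilinear complex.

Set Implicit Arguments.
Unset Strict Implicit.
Unset Printing Implicit Defensive.

Import Order.TTheory GRing.Theory Num.Theory.
Import numFieldNormedType.Exports.

Local Open Scope classical_set_scope.
Local Open Scope group_scope.

(**
The factorization of the connecting maps is formal. The restriction of x : H^N
to A is determined by its restriction to B when A is contained in B, and a
Bohr compactification is a functor that commutes with products of two groups
([bohr_iso], [bohr_prod_iso]); this makes kappa an isomorphism compatible with
the compactification maps ([kappaP]). The displayed composite therefore
carries eta_B to eta_A ([connectingP]). As eta_B has dense range and G_A is
Hausdorff, no other continuous map does, so the composite is the connecting
map, and its existence gives tau_A `<=` tau_B.

For the join, a basic neighbourhood in tau_(A `|` B) prescribes the coordinates
in A, the coordinates in B, and an open condition on the Bohr compactification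
of the remaining power of H. The first condition is tau_A-open, the second
tau_B-open, and the third is tau_A-open because H^(~A) maps onto
H^(~(A `|` B)) and the Bohr compactification is functorial ([tauA_join]).

Injectivity and disjointness come from one dichotomy. Suppose that n belongs
to A but not to B, and look at a coset x H_n of the n-th coordinate copy H_n
of H in H^N. In a compact group, every infinite family has an infinite
subfamily all of whose quotients lie in a given neighbourhood of 1
([compact_infinite_quotient]). In tau_B the group H_n is mapped into a compact
group, so every tau_B-neighbourhood of x contains infinitely many points of x
H_n ([tauA_infinite_coset]). In tau_A the n-th coordinate is discrete, so in
any representation of tau_A a compact set contains the images of only finitely
many points of x H_n ([compact_finite_coset]). Hence tau_A and tau_B differ. If
moreover u belongs to both Fourier algebras and u(x) is not 0, then u is
tau_B-continuous, so it stays close to u(x) at infinitely many points of x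
H_n; but u is, on a group representing tau_A, a uniform limit of functions
with compact support, so it is small outside a finite subset of x H_n. This is
a contradiction ([fourier_of_tauA_disjoint]). The only facts on coefficients
of unitary representations that enter are their continuity and the bound of
the uniform norm by the Fourier-Stieltjes norm, both consequences of the
Cauchy-Schwarz inequality.
*)

(** * Compactness and density in topological groups *)

Lemma hausdorff_prod (S T : topologicalType) :
  hausdorff_space S -> hausdorff_space T -> hausdorff_space (S * T)%type.
Proof.
move=> hS hT [p1 p2] [q1 q2] cl; congr pair.
- apply: hS => U V Up Vq.
  have [[x y] [/= Ux Vx]] := cl (fst @^-1` U) (fst @^-1` V)
    (cvg_fst Up) (cvg_fst Vq).
  by exists x.
- apply: hT => U V Up Vq.
  have [[x y] [/= Ux Vx]] := cl (snd @^-1` U) (snd @^-1` V)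
    (cvg_snd Up) (cvg_snd Vq).
  by exists y.
Qed.

Lemma dense_eq (S T : topologicalType) (D : set S) (f g : S -> T) :
  hausdorff_space T -> dense D -> continuous f -> continuous g ->
  (forall x, D x -> f x = g x) -> f = g.
Proof.
move=> hT dD cf cg fg; apply/funext => x; apply: hT => U V Uf Vg.
have : nbhs x (f @^-1` U `&` g @^-1` V).
  by apply: filterI; [exact: cf|exact: cg].
rewrite nbhsE => -[W [oW Wx] sW].
have [y [Wy Dy]] := dD W (ex_intro _ x Wx) oW.
have [Uy Vy] := sW _ Wy.
by exists (f y); split=> //; rewrite fg.
Qed.

(** The point p is a cluster point of the image under f of the filter of
complements of finite subsets of I. *)
Lemma compact_infinite_fiber (X : topologicalType) (K : set X) (T : Type)
    (I : set T) (f : T -> X) :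
  compact K -> infinite_set I -> (forall t, I t -> K (f t)) ->
  exists p : X, forall U, nbhs p U -> infinite_set (I `&` f @^-1` U).
Proof.
move=> cK infI fK.
pose F : set_system X := [set U | finite_set (I `&` f @^-1` (~` U))].
have FF : ProperFilter F.
  split; first by rewrite /F /= setC0 preimage_setT setIT.
  split.
  - by rewrite /F /= setCT preimage_set0 setI0.
  - move=> U V fU fV; rewrite /F /mkset setCI preimage_setU setIUr.
    by rewrite finite_setU.
  - move=> U V sUV; apply: sub_finite_set => t [It nVt]; split=> // Ut.
    exact/nVt/sUV.
have [|p [_ clp]] := cK F FF.
  rewrite /F /=; suff -> : I `&` f @^-1` (~` K) = set0 by [].
  by rewrite -subset0 => t [/fK].
exists p => U Up finU.
have FU : F (~` U) by rewrite /F /= setCK.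
by have [x [nUx Ux]] := clp _ _ FU Up.
Qed.

(** Near a cluster point p, the quotients of two values of f are close to
p^-1 * p = 1. *)
Lemma compact_infinite_quotient (L : topGroupType) (K : set L) (T : Type)
    (I : set T) (f : T -> L) (V : set L) :
  compact K -> infinite_set I -> (forall t, I t -> K (f t)) -> nbhs 1 V ->
  exists2 J, J `<=` I & infinite_set J /\
    forall a b, J a -> J b -> V ((f a)^-1 * f b).
Proof.
move=> cK infI fK V1.
have [p pP] := compact_infinite_fiber cK infI fK.
have : nbhs (p, p) [set z : L * L | V (z.1^-1 * z.2)].
  have c1 : z.1^-1 @[z --> (p, p)] --> p^-1.
    apply: (@cvg_comp _ _ _ fst (fun x : L => x^-1)); first exact: cvg_fst.
    exact: invg_continuous.
  have c2 : z.1^-1 * z.2 @[z --> (p, p)] --> p^-1 * p.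
    apply: (@cvg_comp _ _ _ (fun z : L * L => (z.1^-1, z.2))
      (fun z : L * L => z.1 * z.2) _ (nbhs (p^-1, p)));
      last exact: (@mulg_continuous L (p^-1, p)).
    exact: cvg_pair c1 cvg_snd.
  by apply: c2; rewrite mulVg.
move=> [[U1 U2] /= [U1p U2p] sU].
exists (I `&` f @^-1` (U1 `&` U2)); first by move=> t [].
split; first by apply/pP/filterI.
by move=> a b [_ [Ua _]] [_ [_ Ub]]; apply: (sU (f a, f b)).
Qed.

Section TopGroup.
Implicit Types L M N P : topGroupType.

Lemma cont_hom_comp L M N (f : L -> M) (g : M -> N) :
  cont_hom f -> cont_hom g -> cont_hom (g \o f).
Proof.
move=> [cf mf] [cg mg]; split; last by move=> x y /=; rewrite mf mg.
by move=> x; apply: continuous_comp; [exact: cf|exact: cg].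
Qed.

Lemma continuous_mulg (T : topologicalType) L (f g : T -> L) :
  continuous f -> continuous g -> continuous (fun t => f t * g t).
Proof.
move=> cf cg t.
apply: (@cvg_comp _ _ _ (fun t => (f t, g t)) (fun z : L * L => z.1 * z.2) _
  (nbhs (f t, g t))); last exact: (@mulg_continuous L (f t, g t)).
by apply: cvg_pair; [exact: cf|exact: cg].
Qed.

Lemma cont_hom_id L : cont_hom (@idfun L).
Proof. by split=> // x. Qed.

Lemma hom1 (L M : groupType) (f : L -> M) : {morph f : x y / x * y} -> f 1 = 1.
Proof.
move=> mf; apply: (@mulgI _ (f 1)).
by rewrite -mf !mulg1.
Qed.

Lemma homV (L M : groupType) (f : L -> M) : {morph f : x y / x * y} ->
  {morph f : x / x^-1}.
Proof.
move=> mf x; apply: (@mulgI _ (f x)).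
by rewrite -mf !mulgV hom1.
Qed.

Lemma cont_hom_fst L M : cont_hom (@fst L M).
Proof. by split=> // x; exact: cvg_fst. Qed.

Lemma cont_hom_snd L M : cont_hom (@snd L M).
Proof. by split=> // x; exact: cvg_snd. Qed.

Lemma cont_hom_pair L M N (f : L -> M) (g : L -> N) :
  cont_hom f -> cont_hom g -> cont_hom (fun x => (f x, g x)).
Proof.
move=> [cf mf] [cg mg]; split; last by move=> x y; rewrite mf mg.
by move=> x; apply: cvg_pair; [exact: cf|exact: cg].
Qed.

Lemma cont_hom_pair_map L M N P (f : L -> N) (g : M -> P) :
  cont_hom f -> cont_hom g -> cont_hom (pair_map f g).
Proof.
move=> hf hg; apply: cont_hom_pair.
  exact: (cont_hom_comp (cont_hom_fst _ _) hf).
exact: (cont_hom_comp (cont_hom_snd _ _) hg).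
Qed.

Lemma dense_pair_map (S T U V : topologicalType) (f : S -> U) (g : T -> V) :
  dense (range f) -> dense (range g) -> dense (range (pair_map f g)).
Proof.
move=> df dg W [[u v] Wuv] oW.
have : nbhs (u, v) W by apply: open_nbhs_nbhs.
move=> [[U1 U2] /= []]; rewrite !nbhsE.
move=> -[W1 [oW1 W1u] s1] [W2 [oW2 W2v] s2] sW.
have [u1 [W1s [s _ sE]]] := df W1 (ex_intro _ u W1u) oW1.
have [v1 [W2t [t _ tE]]] := dg W2 (ex_intro _ v W2v) oW2.
exists (f s, g t); split; last by exists (s, t).
by apply: sW; split=> /=; [apply: s1; rewrite sE|apply: s2; rewrite tE].
Qed.

Lemma compact_group_prod L M :
  compact_group L -> compact_group M -> compact_group (L * M)%type.
Proof.
move=> [hL cL] [hM cM]; split; first exact: hausdorff_prod.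
by rewrite -setXTT; apply: compact_setX.
Qed.

Lemma topgroup_iso_pair_map L M N P (f : L -> N) (g : M -> P) :
  topgroup_iso f -> topgroup_iso g -> topgroup_iso (pair_map f g).
Proof.
move=> [hf [f' [hf' fK f'K]]] [hg [g' [hg' gK g'K]]].
split; first exact: cont_hom_pair_map.
exists (pair_map f' g'); split; first exact: cont_hom_pair_map.
  by move=> [x y]; rewrite /pair_map /= fK gK.
by move=> [x y]; rewrite /pair_map /= f'K g'K.
Qed.

Lemma topgroup_iso_id L : topgroup_iso (@idfun L).
Proof.
by split; [exact: cont_hom_id|exists idfun; split=> //; exact: cont_hom_id].
Qed.

Lemma topgroup_iso_comp L M N (f : L -> M) (g : M -> N) :
  topgroup_iso f -> topgroup_iso g -> topgroup_iso (g \o f).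
Proof.
move=> [hf [f' [hf' fK f'K]]] [hg [g' [hg' gK g'K]]].
split; first exact: cont_hom_comp.
exists (f' \o g'); split; first exact: cont_hom_comp.
  by move=> x /=; rewrite gK fK.
by move=> x /=; rewrite f'K g'K.
Qed.

Lemma intertwines_unique L M N (eta : L -> M) (eta' : L -> N) f g :
  hausdorff_space N -> dense (range eta) ->
  intertwines eta eta' f -> intertwines eta eta' g -> f = g.
Proof.
move=> hN deta [[cf _] fE] [[cg _] gE].
apply: (dense_eq hN deta cf cg) => _ [x _ <-].
by rewrite -[f _]/((f \o eta) x) fE -gE.
Qed.

Lemma intertwinerE L M N (eta : L -> M) (eta' : L -> N) f :
  hausdorff_space N -> dense (range eta) ->
  intertwines eta eta' f -> intertwiner eta eta' = f.
Proof.
move=> hN deta hf; apply: (intertwines_unique hN deta _ hf).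
rewrite /intertwiner; case: xgetP => // /(_ f).
by rewrite /= => /(_ hf).
Qed.

(** The two composites intertwine a dense-range homomorphism with itself, hence
are identities. *)
Lemma intertwines_inv L M N (eta : L -> M) (eta' : L -> N) f g :
  hausdorff_space M -> hausdorff_space N ->
  dense (range eta) -> dense (range eta') ->
  intertwines eta eta' f -> intertwines eta' eta g -> topgroup_iso f.
Proof.
move=> hM hN d d' [hf fE] [hg gE]; split=> //; exists g; split=> //.
  move=> x; rewrite -[g _]/((g \o f) x).
  suff -> : g \o f = idfun by [].
  apply: (intertwines_unique hM d (eta' := eta)).
    by split; [exact: cont_hom_comp|rewrite -compA fE gE].
  by split=> //; exact: cont_hom_id.
move=> x; rewrite -[f _]/((f \o g) x).
suff -> : f \o g = idfun by [].
apply: (intertwines_unique hN d' (eta' := eta')).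
  by split; [exact: cont_hom_comp|rewrite -compA gE fE].
by split=> //; exact: cont_hom_id.
Qed.

End TopGroup.

(** * Functoriality of Bohr compactifications *)

Section Bohr.
Variables (L M : topGroupType) (bL : bohr L) (bM : bohr M).

Lemma bohr_intertwines (f : L -> M) : cont_hom f ->
  exists g : bL -> bM, intertwines (bohr_map bL) (bohr_map bM \o f) g.
Proof.
move=> hf; apply: bohr_universal; first exact: bohr_compact.
exact: cont_hom_comp hf (bohr_hom _).
Qed.

Lemma bohr_iso (f : L -> M) : topgroup_iso f ->
  intertwines (bohr_map bL) (bohr_map bM \o f)
    (intertwiner (bohr_map bL) (bohr_map bM \o f)) /\
  topgroup_iso (intertwiner (bohr_map bL) (bohr_map bM \o f)).
Proof.
move=> [hf [f' [hf' fK f'K]]].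
have [hL _] := bohr_compact bL; have [hM _] := bohr_compact bM.
have [g gP] := bohr_intertwines hf.
rewrite (intertwinerE hM (@bohr_dense _ bL) gP); split=> //.
have dMf : dense (range (bohr_map bM \o f)).
  move=> W W0 oW; have [w [Wy [y _ yE]]] := bohr_dense W0 oW.
  exists (bohr_map bM y); split; first by rewrite yE.
  by exists (f' y) => //=; rewrite f'K.
have [g' [hg' g'E]] : exists g' : bM -> bL,
    intertwines (bohr_map bM) (bohr_map bL \o f') g'.
  apply: bohr_universal; first exact: bohr_compact.
  exact: cont_hom_comp hf' (bohr_hom _).
apply: (intertwines_inv hL hM (@bohr_dense _ bL) dMf gP (g := g')).
split=> //; rewrite compA g'E; apply/funext => x /=; by rewrite fK.
Qed.

Variable bLM : bohr (L * M)%type.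

(** The universal property of bL and bM applied to the two axes of L * M gives
homomorphisms a and b into the compactification of L * M. Their values commute
on a dense set, hence everywhere, so that (s, t) |-> a s * b t is a
homomorphism; its inverse comes from the universal property of bLM, as bL * bM
is compact. *)
Lemma bohr_prod_iso :
  let e := pair_map (bohr_map bL) (bohr_map bM) in
  intertwines e (bohr_map bLM) (intertwiner e (bohr_map bLM)) /\
  topgroup_iso (intertwiner e (bohr_map bLM)).
Proof.
move=> e.
have [hL cL] := bohr_compact bL; have [hM cM] := bohr_compact bM.
have [hLM cLM] := bohr_compact bLM.
have [cb mb] := bohr_hom bLM.
have de : dense (range e) by apply: dense_pair_map; exact: bohr_dense.
have he : cont_hom e by apply: cont_hom_pair_map; exact: bohr_hom.
have hone (N P : topGroupType) : cont_hom (fun _ : N => 1 : P).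
  by split; [move=> x; exact: cvg_cst|move=> x y; rewrite mulg1].
have [a [[ca ma] aE]] : exists a : bL -> bLM,
    intertwines (bohr_map bL) (bohr_map bLM \o (fun x => (x, 1))) a.
  apply: bohr_universal; first exact: bohr_compact.
  apply: cont_hom_comp (bohr_hom _).
  by apply: cont_hom_pair; [exact: cont_hom_id|exact: hone].
have [b [[cb' mb'] bE]] : exists b : bM -> bLM,
    intertwines (bohr_map bM) (bohr_map bLM \o (fun y => (1, y))) b.
  apply: bohr_universal; first exact: bohr_compact.
  apply: cont_hom_comp (bohr_hom _).
  by apply: cont_hom_pair; [exact: hone|exact: cont_hom_id].
have aE' x : a (bohr_map bL x) = bohr_map bLM (x, 1).
  by rewrite -[LHS]/((a \o _) x) aE.
have bE' y : b (bohr_map bM y) = bohr_map bLM (1, y).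
  by rewrite -[LHS]/((b \o _) y) bE.
have ca1 : continuous (fun z : bL * bM => a z.1).
  exact: (cont_hom_comp (cont_hom_fst bL bM) (conj ca ma)).1.
have cb1 : continuous (fun z : bL * bM => b z.2).
  exact: (cont_hom_comp (cont_hom_snd bL bM) (conj cb' mb')).1.
have comm : (fun z => a z.1 * b z.2) = (fun z => b z.2 * a z.1).
  apply: (dense_eq hLM de); [exact: continuous_mulg|exact: continuous_mulg|].
  move=> _ [[x y] _ <-] /=; rewrite aE' bE' -!mb.
  by congr bohr_map; congr pair; rewrite ?mulg1 ?mul1g.
pose f (z : bL * bM) := a z.1 * b z.2.
have fP : intertwines e (bohr_map bLM) f.
  split; last first.
    apply/funext => -[x y]; rewrite /= /f /e /pair_map /= aE' bE' -mb.
    by congr bohr_map; congr pair; rewrite ?mulg1 ?mul1g.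
  split; first exact: continuous_mulg.
  move=> [x y] [x' y']; rewrite /f /= ma mb' !mulgA; congr (_ * _).
  rewrite -!mulgA; congr (_ * _).
  exact: (congr1 (fun F => F (x', y)) comm).
rewrite (intertwinerE hLM de fP); split=> //.
have [g gP] : exists g : bLM -> (bL * bM)%type,
    intertwines (bohr_map bLM) e g.
  apply: bohr_universal => //.
  exact: compact_group_prod (bohr_compact _) (bohr_compact _).
apply: (intertwines_inv _ hLM de (@bohr_dense _ bLM) fP gP).
exact: hausdorff_prod.
Qed.

End Bohr.

(** * Powers of a group *)

Section PowerTheory.
Variable H : groupType.
Implicit Types A B C : set nat.

Lemma hpow_nbhs A (x : hpow H A) (U : set (hpow H A)) : U x -> nbhs x U.
Proof. by move=> Ux; apply/principal_filterP. Qed.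

Lemma hpow_open A (U : set (hpow H A)) : open U.
Proof. by rewrite openE => x Ux; exact: hpow_nbhs. Qed.

Lemma hpow_continuous A (T : topologicalType) (f : hpow H A -> T) :
  continuous f.
Proof. by move=> x U /nbhs_singleton Ufx; exact: hpow_nbhs. Qed.

Lemma hpow2_continuous A B (T : topologicalType)
  (f : hpow H A * hpow H B -> T) : continuous f.
Proof.
move=> [x y] U /nbhs_singleton Ufx.
exists ([set x], [set y]) => /=; first by split; exact: hpow_nbhs.
by move=> [a b] [/= -> ->].
Qed.

(** Restriction maps rebuild the membership proof carried by an index; any two
of them have to be identified. *)
Lemma hpow_index A (x : hpow H A) n (p q : n \in A) :
  x (exist _ n p) = x (exist _ n q).
Proof. by congr (x _); apply: val_inj. Qed.

Lemma hpowM A (x y : hpow H A) i : (x * y) i = x i * y i.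
Proof. by []. Qed.

Lemma hprojM A B (sAB : A `<=` B) : {morph @hproj H _ _ sAB : x y / x * y}.
Proof. by []. Qed.

Lemma cont_hom_hproj A B (sAB : A `<=` B) : cont_hom (@hproj H _ _ sAB).
Proof. by split; [exact: hpow_continuous|exact: hprojM]. Qed.

Lemma hproj_comp A B C (sAB : A `<=` B) (sBC : B `<=` C) (sAC : A `<=` C)
    (x : hpow H C) :
  hproj sAB (hproj sBC x) = hproj sAC x.
Proof.
by apply/funext => -[n p]; rewrite /hproj /=; exact: hpow_index.
Qed.

Lemma hsplitK A B C (sAC : A `<=` C) (sBC : B `<=` C) (sC : C `<=` A `|` B)
    (x : hpow H C) :
  hglue sC (hproj sAC x, hproj sBC x) = x.
Proof.
apply/funext => -[n p]; rewrite /hglue /hproj /=.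
by case: pselect => ?; exact: hpow_index.
Qed.

Lemma hglue_hom A B C (sC : C `<=` A `|` B) : cont_hom (@hglue H _ _ _ sC).
Proof.
split; first exact: hpow2_continuous.
move=> [x1 x2] [y1 y2]; apply/funext => -[n p]; rewrite hpowM /hglue /=.
by case: pselect.
Qed.

Lemma hsplit_hom A B C (sAC : A `<=` C) (sBC : B `<=` C) :
  cont_hom (@hsplit H _ _ _ sAC sBC).
Proof. by split; [exact: hpow_continuous|]. Qed.

Lemma hglueK A B C (sAC : A `<=` C) (sBC : B `<=` C) (sC : C `<=` A `|` B) :
  A `&` B = set0 -> cancel (@hglue H _ _ _ sC) (hsplit sAC sBC).
Proof.
move=> AB0 [x y]; congr pair; apply/funext => -[n p]; rewrite /hproj /hglue /=.
  case: pselect => [?|[]]; first exact: hpow_index.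
  exact: set_mem p.
case: pselect => [An|?]; last exact: hpow_index.
have : set0 n by rewrite -AB0; split=> //; exact: set_mem p.
by [].
Qed.

Lemma hglue_iso A B C (sAC : A `<=` C) (sBC : B `<=` C) (sC : C `<=` A `|` B) :
  A `&` B = set0 -> topgroup_iso (@hglue H _ _ _ sC).
Proof.
move=> AB0; split; first exact: hglue_hom.
exists (hsplit sAC sBC); split; first exact: hsplit_hom.
  exact: hglueK.
exact: hsplitK.
Qed.

Lemma hsplit_iso A B C (sAC : A `<=` C) (sBC : B `<=` C) :
  C `<=` A `|` B -> A `&` B = set0 -> topgroup_iso (@hsplit H _ _ _ sAC sBC).
Proof.
move=> sC AB0; split; first exact: hsplit_hom.
exists (hglue sC); split; first exact: hglue_hom.
  exact: hsplitK.
exact: hglueK.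
Qed.

Definition coord n (x : hpow H [set: nat]) : H := x (exist _ n (mem_set I)).

(** The embedding of H onto its n-th coordinate copy in H^N. *)
Definition single n (h : H) : hpow H [set: nat] :=
  fun i => if \val i == n then h else 1.

Lemma coord_single n h : coord n (single n h) = h.
Proof. by rewrite /coord /single /= eqxx. Qed.

Lemma singleM n : {morph single n : h k / h * k}.
Proof.
move=> h k; apply/funext => i; rewrite hpowM /single.
by case: ifP; rewrite // mulg1.
Qed.

Lemma hproj_single A n h : ~ A n -> hproj (@subsetT _ A) (single n h) = 1.
Proof.
move=> nAn; apply/funext => -[m p]; rewrite /hproj /single /=.
by case: eqP => // mn; case: nAn; rewrite -mn; exact: set_mem p.
Qed.

End PowerTheory.

(** * Topologies induced by homomorphisms *)

Lemma induced_is_topology (G L : topGroupType) (eta : G -> L) :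
  is_topology (induced_topology eta).
Proof.
split.
- by exists setT; [exact: openT|rewrite preimage_setT].
- move=> _ _ [U oU <-] [V oV <-]; exists (U `&` V); first exact: openI.
  by rewrite preimage_setI.
- move=> C sC.
  exists (\bigcup_(V in [set V | open V /\ C (eta @^-1` V)]) V).
    by apply: bigcup_open => V [].
  rewrite preimage_bigcup eqEsubset; split=> x.
    by move=> [V [_ CV] Vx]; exists (eta @^-1` V).
  move=> [U CU Ux]; have [V oV VU] := sC _ CU.
  exists V; first by rewrite /= VU.
  by rewrite -VU in Ux.
Qed.

Lemma is_topology_nbhs (G : topGroupType) (rho : set (set G)) (U : set G) :
  is_topology rho ->
  (forall x, U x -> exists2 V, rho V & V x /\ V `<=` U) -> rho U.
Proof.
move=> [_ _ rhoU] sU.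
suff -> : U = \bigcup_(V in [set V | rho V /\ V `<=` U]) V.
  by apply: rhoU => V [].
rewrite eqEsubset; split=> x.
  by move=> /sU[V rV [Vx sV]]; exists V.
by move=> [V [_ sV] /sV].
Qed.

(** * The topologies tau_A *)

Section TauTheory.
Variables (H : groupType) (ap : forall L : topGroupType, bohr L).
Implicit Types A B C : set nat.

Lemma eta_ap_hom A : cont_hom (eta_ap H ap A).
Proof. exact: bohr_hom. Qed.

Lemma eta_ap_dense A : dense (range (eta_ap H ap A)).
Proof. exact: bohr_dense. Qed.

Lemma etaA_hom A : cont_hom (etaA H ap A).
Proof.
apply: cont_hom_pair; first exact: cont_hom_hproj.
exact: cont_hom_comp (cont_hom_hproj _ _) (eta_ap_hom _).
Qed.

Lemma hausdorff_GA A : hausdorff_space (GA H ap A).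
Proof.
apply: hausdorff_prod; first exact: discrete_hausdorff.
by have [] := bohr_compact (ap (hpow H (~` A))).
Qed.

(** Up to the splitting of H^N into H^A and H^(~A), the map eta_A is the product
of an identity map and a compactification map. *)
Lemma etaA_dense A : dense (range (etaA H ap A)).
Proof.
have sT : [set: nat] `<=` A `|` ~` A by rewrite setUv.
have -> : range (etaA H ap A) =
    range (pair_map (@id (hpow H A)) (eta_ap H ap (~` A))).
  rewrite eqEsubset; split=> _ [x _ <-].
    by exists (hsplit (@subsetT _ A) (@subsetT _ (~` A)) x).
  exists (hglue sT x) => //.
  rewrite -[RHS]/(pair_map _ _ _) -[in RHS](hglueK (@subsetT _ A)
    (@subsetT _ (~` A)) sT (setICr A) x).
  by [].
apply: dense_pair_map; last exact: eta_ap_dense.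
by move=> U [x Ux] _; exists x; split=> //; exists x.
Qed.

Lemma locally_compact_GA A : locally_compact [set: GA H ap A].
Proof.
have [hK cK] := bohr_compact (ap (hpow H (~` A))).
move=> [a k] _; exists ([set a] `*` setT).
  exists ([set a], setT) => /=.
    by split; [exact: hpow_nbhs|exact: filterT].
  by move=> [b l] [/= -> _].
have cp : compact ([set a] `*` [set: hpow_ap H ap (~` A)]).
  by apply: compact_setX => //; exact: compact_set1.
by split=> //; apply: compact_closed => //; exact: hausdorff_GA.
Qed.

Lemma tauA_representation A : representation (etaA H ap A) (tauA H ap A).
Proof.
split=> //; last exact: etaA_dense.
- by split; [exact: hausdorff_GA|exact: locally_compact_GA].
- exact: etaA_hom.
Qed.

Lemma tauA_coord A n : A n -> tauA H ap A [set x | coord n x = 1].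
Proof.
move=> An; exists [set z | z.1 (exist _ n (mem_set An)) = 1]; last first.
  have E x : hproj (@subsetT _ A) x (exist _ n (mem_set An)) = coord n x.
    by rewrite /hproj /coord /=; exact: hpow_index.
  by apply/funext => x; apply/propext; split=> /=; rewrite -[coord n x]E.
rewrite -[X in open X]/(fst @^-1`
  [set a : hpow H A | a (exist _ n (mem_set An)) = 1]).
apply: open_comp; last exact: hpow_open.
by move=> z _; exact: cvg_fst.
Qed.

Lemma tauA_comp A (T : topologicalType) (g : GA H ap A -> T) (U : set T) :
  continuous g -> open U -> tauA H ap A [set x | U (g (etaA H ap A x))].
Proof.
move=> cg oU; exists (g @^-1` U) => //.
by apply: open_comp => // z _; exact: cg.
Qed.

Lemma tauA_hproj A C (sCA : C `<=` A) (U : set (hpow H C)) :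
  tauA H ap A [set x | U (hproj (@subsetT _ C) x)].
Proof.
have hg := cont_hom_comp (cont_hom_fst (hpow H A) (hpow_ap H ap (~` A)))
  (cont_hom_hproj H sCA).
have -> : [set x | U (hproj (@subsetT _ C) x)] =
    [set x | U ((hproj sCA \o fst) (etaA H ap A x))].
  apply/funext => x /=.
  by rewrite (hproj_comp sCA (@subsetT _ A) (@subsetT _ C)).
by apply: tauA_comp; [exact: hg.1|exact: hpow_open].
Qed.

(** The homomorphism H^(~A) -> (H^(~B))^ap factors through (H^(~A))^ap, a factor
of G_A. *)
Lemma tauA_eta_ap A B (sAB : A `<=` B) (U : set (hpow_ap H ap (~` B))) :
  open U ->
  tauA H ap A
    [set x | U (eta_ap H ap (~` B) (hproj (@subsetT _ (~` B)) x))].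
Proof.
move=> oU.
have sC : ~` B `<=` ~` A by apply: subsetC.
have [g [hg gE]] := bohr_intertwines (ap (hpow H (~` A))) (ap (hpow H (~` B)))
  (cont_hom_hproj H sC).
have -> : [set x | U (eta_ap H ap (~` B) (hproj (@subsetT _ (~` B)) x))] =
    [set x | U ((g \o snd) (etaA H ap A x))].
  apply/funext => x /=; rewrite -[g _]/((g \o _) _) gE /=.
  by rewrite (hproj_comp sC (@subsetT _ (~` A)) (@subsetT _ (~` B))).
apply: tauA_comp => //.
exact: (cont_hom_comp (cont_hom_snd (hpow H A) (hpow_ap H ap (~` A))) hg).1.
Qed.

(** As n is not in A, the coset of x under the n-th copy of H has a constant
projection to H^A, while its image in the Bohr compactification accumulates:
infinitely many of the quotients a^-1 h are close to 1. *)
Lemma tauA_infinite_coset A n (U : set (hpow H [set: nat])) x :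
  infinite_set [set: H] -> ~ A n -> tauA H ap A U -> U x ->
  infinite_set [set h | U (x * single n h)].
Proof.
move=> infH nAn [V oV <-] Vx.
have [hK cK] := bohr_compact (ap (hpow H (~` A))).
pose eK := eta_ap H ap (~` A).
have [_ mK] := eta_ap_hom (~` A).
pose f h := eK (hproj (@subsetT _ (~` A)) (single n h)).
have fM h k : f (h * k) = f h * f k by rewrite /f singleM hprojM /eK mK.
pose xA := hproj (@subsetT _ A) x.
pose xK := eK (hproj (@subsetT _ (~` A)) x).
pose W := [set k | V (xA, xK * k)].
have W1 : nbhs 1 W.
  have c : continuous (fun k : hpow_ap H ap (~` A) => (xA, xK * k)).
    move=> k.
    apply: (@cvg_pair _ _ _ (nbhs k) (nbhs xA) (nbhs (xK * k)) _ _ _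
      (fun=> xA) (fun k => xK * k)).
      exact: cvg_cst.
    by apply: (continuous_mulg (f := fun=> _) (g := id)) => t; [exact: cvg_cst|].
  apply: (c 1); apply: open_nbhs_nbhs; split=> //.
  by rewrite mulg1.
have [J _ [infJ JW]] :=
  compact_infinite_quotient cK infH (f := f) (fun _ _ => I) W1.
have [a Ja] : J !=set0 by apply/set0P/eqP => J0; apply: infJ; rewrite J0.
move=> fin; apply: infJ; apply: (@sub_finite_set _ _
  [set a * h | h in [set h | V (etaA H ap A (x * single n h))]]).
  move=> h Jh; exists (a^-1 * h); last by rewrite mulVKg.
  rewrite /= /etaA hprojM hproj_single // mulg1 hprojM mK.
  rewrite -[eta_ap _ _ _ (hproj _ (single _ _))]/(f _) fM.
  have -> : f a^-1 = (f a)^-1 by apply: homV.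
  exact: JW.
exact: finite_image.
Qed.

(** If infinitely many points x h of the coset fell into K, two different ones
would have a quotient a^-1 b whose image is so close to 1 that its n-th
coordinate is trivial. *)
Lemma compact_finite_coset (L : topGroupType) (eta : hpow H [set: nat] -> L)
    (K : set L) n x :
  {morph eta : x y / x * y} -> compact K ->
  induced_topology eta [set x | coord n x = 1] ->
  finite_set [set h | K (eta (x * single n h))].
Proof.
move=> me cK [V oV VE].
have V1 : nbhs 1 V.
  apply: open_nbhs_nbhs; split=> //; rewrite -(hom1 me).
  by rewrite -[V _]/((eta @^-1` V) 1) VE.
apply: contrapT => inf.
have [J sJ [infJ JV]] := compact_infinite_quotient cK inf
  (f := fun h => eta (x * single n h)) (fun _ h => h) V1.
apply: infJ; have [->|/set0P[a Ja]] := eqVneq J set0; first exact: finite_set0.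
apply: (@sub_finite_set _ _ [set a]) => // b Jb /=.
have := JV _ _ Ja Jb.
rewrite -(homV me) -me invgM -mulgA mulKg.
rewrite -[V _]/((eta @^-1` V) _) VE /=.
rewrite -[coord _ _]/((coord n (single n a))^-1 * coord n (single n b)).
rewrite !coord_single.
by move=> /(congr1 (fun k => a * k)); rewrite mulVKg mulg1.
Qed.

(** Both factors of kappa are intertwiners that exist by functoriality; as
~` A is the disjoint union of B `\` A and ~` B, gluing is an isomorphism. *)
Lemma kappaP A B : A `<=` B ->
  topgroup_iso (kappa H ap A B) /\
  kappa H ap A B \o pair_map (eta_ap H ap (B `\` A)) (eta_ap H ap (~` B)) =
    eta_ap H ap (~` A) \o hglue (@setC_split A B).
Proof.
move=> sAB.
have [[_ psiE] psi_iso] := bohr_prod_iso (ap (hpow H (B `\` A)))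
  (ap (hpow H (~` B))) (ap (hpow H (B `\` A) * hpow H (~` B))%type).
have disj : (B `\` A) `&` ~` B = set0 by apply/seteqP; split=> n // [[Bn _]].
have sBA : B `\` A `<=` ~` A by move=> n [].
have sB : ~` B `<=` ~` A by apply: subsetC.
have [[_ lamE] lam_iso] :=
  bohr_iso (ap (hpow H (B `\` A) * hpow H (~` B))%type) (ap (hpow H (~` A)))
    (hglue_iso H sBA sB (@setC_split A B) disj).
split; first exact: topgroup_iso_comp psi_iso lam_iso.
by rewrite /kappa -compA [X in _ \o X]psiE [LHS]lamE.
Qed.

(** On the image of eta_B, the second component reduces to the identity
satisfied by kappa on pairs of restrictions of one point of H^N. *)
Lemma connectingP A B (sAB : A `<=` B) :
  intertwines (etaA H ap B) (etaA H ap A)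
    (pair_map idfun (kappa H ap A B)
      \o pair_map idfun (pair_map (eta_ap H ap (B `\` A)) idfun)
      \o (@pair_assoc _ _ _)
      \o pair_map (hsplit (H := H) sAB (@subDsetl _ B A)) idfun).
Proof.
have [[hk _] kE] := kappaP sAB.
split.
  apply: (@cont_hom_comp _
    ((hpow H A * hpow H (B `\` A)) * hpow_ap H ap (~` B))%type).
    by apply: cont_hom_pair_map; [exact: hsplit_hom|exact: cont_hom_id].
  apply: (@cont_hom_comp _
    (hpow H A * (hpow H (B `\` A) * hpow_ap H ap (~` B)))%type).
    apply: cont_hom_pair.
      exact: cont_hom_comp (cont_hom_fst _ _) (cont_hom_fst _ _).
    apply: cont_hom_pair; last exact: cont_hom_snd.
    exact: cont_hom_comp (cont_hom_fst _ _) (cont_hom_snd _ _).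
  apply: (@cont_hom_comp _
    (hpow H A * (hpow_ap H ap (B `\` A) * hpow_ap H ap (~` B)))%type).
    apply: cont_hom_pair_map; first exact: cont_hom_id.
    by apply: cont_hom_pair_map; [exact: eta_ap_hom|exact: cont_hom_id].
  by apply: cont_hom_pair_map; first exact: cont_hom_id.
apply/funext => x; rewrite /etaA; congr pair => /=.
  by rewrite /pair_map /= (hproj_comp sAB (@subsetT _ B) (@subsetT _ A)).
rewrite /pair_map /=.
have := congr1 (fun f => f (hproj (@subDsetl _ B A) (hproj (@subsetT _ B) x),
  hproj (@subsetT _ (~` B)) x)) kE.
rewrite /= /pair_map /= => ->; congr (eta_ap _ _ _ _).
rewrite (hproj_comp (@subDsetl _ B A) (@subsetT _ B) (@subsetT _ (B `\` A))).
have sBA : B `\` A `<=` ~` A by move=> n [].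
have sB : ~` B `<=` ~` A by apply: subsetC.
rewrite -(hproj_comp sBA (@subsetT _ (~` A)) (@subsetT _ (B `\` A))).
by rewrite -(hproj_comp sB (@subsetT _ (~` A)) (@subsetT _ (~` B))) hsplitK.
Qed.

Lemma tauA_sub A B : A `<=` B -> tauA H ap A `<=` tauA H ap B.
Proof.
move=> sAB U [V oV <-]; have [[cg _] gE] := connectingP sAB.
by rewrite -gE; exact: (tauA_comp cg oV).
Qed.

(** For the inclusion from left to right, the topology rho is arbitrary, so that
openness is checked on neighbourhoods built from tau_A- and tau_B-open sets. *)
Lemma tauA_join A B :
  tauA H ap (A `|` B) = topology_join (tauA H ap A) (tauA H ap B).
Proof.
apply/seteqP; split.
  move=> _ [V oV <-] rho [rhoT srho]; apply: (is_topology_nbhs rhoT) => x Vx.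
  have /= : nbhs (etaA H ap (A `|` B) x) V by apply: open_nbhs_nbhs.
  move=> [[V1 V2] /= [V1x]]; rewrite nbhsE => -[W [oW Wx] sW] sV.
  case: (rhoT) => _ rI _.
  exists ([set y | hproj (@subsetT _ A) y = hproj (@subsetT _ A) x] `&`
          [set y | hproj (@subsetT _ B) y = hproj (@subsetT _ B) x] `&`
          [set y | W (eta_ap H ap (~` (A `|` B))
                        (hproj (@subsetT _ (~` (A `|` B))) y))]).
    apply: (rI); first apply: (rI).
    - apply: srho; left.
      exact: (tauA_hproj (@subset_refl _ A) [set hproj (@subsetT _ A) x]).
    - apply: srho; right.
      exact: (tauA_hproj (@subset_refl _ B) [set hproj (@subsetT _ B) x]).
    - by apply: srho; left; exact: (tauA_eta_ap (@subsetUl _ A B) oW).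
  split=> // y [[/= Ay By] Wy]; apply: sV; split; last exact: sW.
  suff -> : (etaA H ap (A `|` B) y).1 = (etaA H ap (A `|` B) x).1.
    exact: nbhs_singleton V1x.
  apply/funext => -[n p] /=; rewrite /hproj /=.
  have [An|Bn] := set_mem p.
    have := congr1 (fun z => z (exist _ n (mem_set An))) Ay.
    rewrite /hproj /= => E.
    by etransitivity; [|etransitivity; [exact: E|]]; exact: hpow_index.
  have := congr1 (fun z => z (exist _ n (mem_set Bn))) By.
  rewrite /hproj /= => E.
  by etransitivity; [|etransitivity; [exact: E|]]; exact: hpow_index.
move=> U; apply; split; first exact: induced_is_topology.
move=> V [|]; first exact: (tauA_sub (@subsetUl _ A B)).
exact: (tauA_sub (@subsetUr _ A B)).
Qed.

Lemma tauA_separated A B n : infinite_set [set: H] ->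
  A n -> ~ B n -> tauA H ap A <> tauA H ap B.
Proof.
move=> infH An nBn eqT.
have oU := tauA_coord An; rewrite eqT in oU.
have := tauA_infinite_coset infH nBn oU (x := 1) erefl; apply.
apply: (@sub_finite_set _ _ [set 1]) => // h /=.
by rewrite mul1g coord_single.
Qed.

Lemma tauA_inj : infinite_set [set: H] -> injective (tauA H ap).
Proof.
move=> infH A B eqT; apply/seteqP; split=> n.
  by move=> An; apply: contrapT => nBn; exact: (tauA_separated infH An nBn).
by move=> An; apply: contrapT => nBn; exact: (tauA_separated infH An nBn).
Qed.

End TauTheory.

(** * Coefficients of unitary representations *)

Section Coefficients.
Local Open Scope ring_scope.

(** The component w of u orthogonal to v only increases the right-hand side. *)
Lemma form_CauchySchwarz (C : numClosedFieldType) (U : lmodType C)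
    (form : {dot U for Num.conj_op}) (u v : U) :
  `|form u v| ^+ 2 <= form u u * form v v.
Proof.
have [-> | nz_v] := eqVneq v 0.
  by rewrite !linear0r normr0 expr0n.
have gt_v : 0 < form v v by rewrite neq0_dnorm_gt0.
have nz_vv : form v v != 0 by rewrite gt_eqF.
have [w [orth ->]] :
    exists w, form w v = 0 /\ u = w + (form u v / form v v) *: v.
  exists (u - (form u v / form v v) *: v); split; last by rewrite subrK.
  by rewrite linearBl /= linearZl_LR /= divfK ?subrr.
set a := form u v / form v v.
rewrite linearDl /= orth add0r linearZl_LR /= normrM exprMn.
rewrite (ger0_norm (ltW gt_v)).
rewrite [form (w + _) (w + _)]hnormDd /=; last first.
  by rewrite linearZr_LR /= orth mulr0.
rewrite dnormZ mulrDl expr2 mulrA lerDr.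
by rewrite mulr_ge0 ?dnorm_ge0 // ltW.
Qed.

Variable R : realType.

Lemma hilbert_CauchySchwarz (V : hilbert R) (x y : V) :
  `|hilbert_ip V x y| <= `|x| * `|y|.
Proof.
rewrite -(@ler_pXn2r _ 2) ?nnegrE ?mulr_ge0 //.
by rewrite exprMn !hilbert_normE form_CauchySchwarz.
Qed.

Lemma coefficient_continuous (L : topGroupType) (u : L -> R[i]) x (e : R) :
  fourier_stieltjes u -> 0 < e -> nbhs x [set y | `|u y - u x| < e%:C%C].
Proof.
move=> [r [V [pi [xi [eta [[_ _ _ _ cpi] uE _]]]]]] e0.
have e0C : 0 < e%:C%C :> R[i] by rewrite ltcR.
pose d : R[i] := e%:C%C / (`|eta| + 1).
have eta1 : 0 < `|eta| + 1 by rewrite ltr_wpDl.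
have d0 : 0 < d by rewrite divr_gt0.
have /cvgrPdist_lt/(_ d d0) := cpi xi x.
apply: filterS => y /=; rewrite !uE => xy.
rewrite -linearBl; apply: (le_lt_trans (hilbert_CauchySchwarz _ _)).
rewrite distrC in xy.
apply: (@le_lt_trans _ _ (d * `|eta|)).
  by apply: ler_wpM2r => //; exact: ltW.
apply: (@lt_le_trans _ _ (d * (`|eta| + 1))).
  by rewrite ltr_pM2l // ltrDl.
by rewrite /d divfK // gt_eqF.
Qed.

Lemma fs_norm_bound (L : topGroupType) (u : L -> R[i]) (e : R) x :
  (fs_norm u < e%:E)%E -> `|u x| < e%:C%C.
Proof.
move=> /ereal_inf_lt[_ [r [V [pi [xi [eta [[_ _ _ ipi _] uE rE]]]]] <-]].
rewrite lte_fin => re.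
rewrite uE; apply: (le_lt_trans (hilbert_CauchySchwarz _ _)).
have -> : `|pi x xi| = `|xi|.
  by apply/eqP; rewrite -(@eqrXn2 _ 2) // !hilbert_normE ipi.
by rewrite -rE ltcR.
Qed.

End Coefficients.

(** * The zero function in the Fourier algebra *)

Section ZeroSpace.
Local Open Scope ring_scope.
Variable R : realType.

(** The zero function is a coefficient of the representation on the zero Hilbert
space; a 1 x 0 matrix space already carries the norm, and its completeness is
immediate. *)
Definition zero_space : Type := 'rV[R[i]]_0.

HB.instance Definition _ := NormedModule.copy zero_space 'rV[R[i]]_0.

Lemma zero_spaceE (x : zero_space) : x = 0.
Proof. by apply/matrixP => i []. Qed.

Lemma zero_space_cauchy_cvg (F : set_system zero_space) :
  ProperFilter F -> cauchy F -> cvg F.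
Proof.
move=> FF _; apply/cvg_ex; exists 0 => U /nbhs_singleton U0.
by apply: filterS filterT => x _; rewrite (zero_spaceE x).
Qed.

HB.instance Definition _ :=
  Uniform_isComplete.Build zero_space zero_space_cauchy_cvg.

Definition zero_form (x y : zero_space) : R[i] := 0.

Lemma zero_form_linearl y : linear_for *%R (zero_form ^~ y).
Proof. by move=> a u v; rewrite /zero_form mulr0 addr0. Qed.

Lemma zero_form_linearr x : linear_for (@Num.conj_op R[i] \; *%R) (zero_form x).
Proof. by move=> a u v; rewrite /zero_form /= mulr0 addr0. Qed.

HB.instance Definition _ :=
  bilinear_isBilinear.Build R[i] zero_space zero_space R[i]
    *%R (@Num.conj_op R[i] \; *%R) zero_form
    (zero_form_linearl, zero_form_linearr).

Lemma zero_form_herm x y :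
  zero_form x y = (-1) ^+ false * Num.conj_op (zero_form y x).
Proof. by rewrite /zero_form rmorph0 mulr0. Qed.

HB.instance Definition _ :=
  isHermitianSesquilinear.Build R[i] zero_space false (@Num.conj_op R[i])
    zero_form zero_form_herm.

Lemma zero_form_pos x : x != 0 -> 0 < zero_form x x.
Proof. by rewrite (zero_spaceE x) eqxx. Qed.

HB.instance Definition _ :=
  isDotProduct.Build R[i] zero_space zero_form zero_form_pos.

Lemma zero_normE (x : zero_space) : `|x| ^+ 2 = zero_form x x.
Proof. by rewrite (zero_spaceE x) normr0 expr0n. Qed.

Definition zero_hilbert : hilbert R :=
  @Hilbert R zero_space zero_form zero_normE.

Lemma fourier0 (L : topGroupType) : fourier (fun _ : L => 0 : R[i]).
Proof.
have b0 : coefficient_bounds (fun _ : L => 0 : R[i]) 0.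
  exists zero_hilbert, (fun _ => id), 0, 0; split=> //.
    by split=> // v x; exact: cvg_cst.
  by rewrite normr0 mulr0.
split; first by exists 0.
move=> e e0; exists (fun=> 0); split; first by exists 0.
  rewrite /compact_support.
  suff -> : [set x : L | (0 : R[i]) != 0] = set0.
    by rewrite closure0; exact: compact0.
  by apply/seteqP; split=> x //=; rewrite eqxx.
apply: (@le_lt_trans _ _ 0%E); last by rewrite lte_fin.
apply: ereal_inf_lbound; exists 0 => //.
by under eq_fun do rewrite subr0.
Qed.

End ZeroSpace.

(** * Disjointness *)

(** With 2 e = |u x|: on the coset of x, the distance from u to u x is less than
e infinitely often, and |u| is less than e outside a finite set. *)
Lemma fourier_of_tauA_disjoint (R : realType) (H : groupType)
    (ap : forall L : topGroupType, bohr L) A B n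
    (u : hpow H [set: nat] -> R[i]) :
  infinite_set [set: H] -> A n -> ~ B n ->
  fourier_of_topology (tauA H ap A) u -> fourier_of_topology (tauA H ap B) u ->
  u = (fun=> 0%R).
Proof.
move=> infH An nBn [L [eta [v [repA [fsv fv] uE]]]].
move=> [M [theta [w [[_ [_ mt] _ tauE] [fsw _] uE']]]].
case: repA => _ [_ me] _ tauAE.
apply/funext => x; apply: contrapT => /eqP ux.
have norm_u : (0 < `|u x|)%R by rewrite normr_gt0.
have [e e0 eE] : exists2 e : R, (0 < e)%R & (e%:C%C *+ 2 = `|u x|)%R.
  have ur : (complex.Re (`|u x|%R))%:C%C = `|u x|%R.
    by rewrite RRe_real // normr_real.
  exists (complex.Re (`|u x|%R) / 2)%R.
    by rewrite divr_gt0 // -ltcR ur.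
  by rewrite -[in RHS]ur -rmorphMn /= -mulr_natr divfK // pnatr_eq0.
have [f [_ cf uf]] := fv e e0.
have fin :
    finite_set [set h | closure [set y | f y != 0%R] (eta (x * single n h))].
  by apply: compact_finite_coset cf _ => //; rewrite -tauAE; exact: tauA_coord.
have := coefficient_continuous (theta x) fsw e0.
rewrite nbhsE => -[W [oW Wx] sW].
have oWB : tauA H ap B (theta @^-1` W) by rewrite tauE; exists W.
apply: (tauA_infinite_coset infH nBn oWB Wx).
apply: sub_finite_set fin => h /sW /= wx.
apply: subset_closure => /=; apply/eqP => fh.
have := fs_norm_bound (eta (x * single n h)) uf; rewrite fh subr0 => vx.
rewrite -[w _]/((w \o theta) _) -[w (theta x)]/((w \o theta) x) -uE' in wx.
rewrite -[v _]/((v \o eta) _) -uE in vx.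
have : (`|u x| < e%:C%C + e%:C%C)%R.
  apply: le_lt_trans (ltrD wx vx).
  rewrite distrC -{1}(subrK (u (x * single n h)) (u x)).
  exact: ler_normD.
by rewrite -mulr2n eE ltxx.
Qed.

Lemma range_tauA_disjoint (R : realType) (H : groupType)
    (ap : forall L : topGroupType, bohr L) :
  infinite_set [set: H] -> disjoint_topologies R (range (tauA H ap)).
Proof.
move=> infH _ _ [A _ <-] [B _ <-] neqAB; apply/seteqP; split=> u; last first.
  have zero C : fourier_of_topology (tauA H ap C) (fun=> 0%R : R[i]).
    exists (GA H ap C), (etaA H ap C), (fun=> 0%R); split=> //.
      exact: tauA_representation.
    exact: fourier0.
  by move=> ->; split; exact: zero.
move=> [uA uB] /=; apply: contrapT => u_neq0; apply: neqAB; congr (tauA H ap _).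
apply/seteqP; split=> n Cn; apply: contrapT => nCn; apply: u_neq0.
  exact: (fourier_of_tauA_disjoint infH Cn nCn uA uB).
exact: (fourier_of_tauA_disjoint infH Cn nCn uB uA).
Qed.

Local Close Scope group_scope.

Theorem theorem4p3 (R : realType) (H : groupType)
    (H_infinite : infinite_set [set: H])
    (ap : forall L : topGroupType, bohr L) :
  (* A |-> tau_A is an upper semilattice monomorphism into T(H^N) *)
  [/\ forall A : set nat, locally_precompact (tauA H ap A),
      injective (tauA H ap) &
      forall A B : set nat,
        tauA H ap (A `|` B) = topology_join (tauA H ap A) (tauA H ap B)] /\
  (* factorization of the canonical map eta^B_A *)
  (forall (A B : set nat) (sAB : A `<=` B),
    let phi := hsplit (H := H) sAB (@subDsetl _ B A) in
    let k := kappa H ap A B in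
    [/\ tauA H ap A `<=` tauA H ap B,
        unique (intertwines (etaA H ap B) (etaA H ap A))
               (connecting H ap A B),
        connecting H ap A B =
          pair_map idfun k
          \o pair_map idfun (pair_map (eta_ap H ap (B `\` A)) idfun)
          \o (@pair_assoc _ _ _)
          \o pair_map phi idfun,
        topgroup_iso
          (pair_map phi idfun :
            (hpow H B * hpow_ap H ap (~` B))%type ->
            ((hpow H A * hpow H (B `\` A)) * hpow_ap H ap (~` B))%type)
      & topgroup_iso
          (pair_map idfun k :
            (hpow H A
              * (hpow_ap H ap (B `\` A) * hpow_ap H ap (~` B)))%type ->
            (hpow H A * hpow_ap H ap (~` A))%type)]) /\
  (* {tau_A} is a disjoint subsemilattice *)
  (subsemilattice (range (tauA H ap)) /\
   disjoint_topologies R (range (tauA H ap))).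
Proof.
split; [|split].
- split; last exact: tauA_join.
    by move=> A; exists (GA H ap A), (etaA H ap A); exact: tauA_representation.
  exact: tauA_inj.
- move=> A B sAB phi k.
  have etaAB := connectingP H ap sAB.
  have conE : connecting H ap A B = _ :=
    intertwinerE (@hausdorff_GA H ap A) (@etaA_dense H ap B) etaAB.
  split.
  + exact: tauA_sub.
  + rewrite conE; split=> // g; apply: intertwines_unique etaAB.
      exact: hausdorff_GA.
    exact: etaA_dense.
  + exact: conE.
  + apply: topgroup_iso_pair_map (topgroup_iso_id _); apply: hsplit_iso.
      by move=> n Bn; have [|] := pselect (A n); [left|right].
    by apply/seteqP; split=> n // [An []].
  + apply: topgroup_iso_pair_map (topgroup_iso_id _) _.
    by have [] := kappaP H ap sAB.
- split; last exact: range_tauA_disjoint.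
  split.
    by move=> _ [A _ <-]; exists (GA H ap A), (etaA H ap A);
       exact: tauA_representation.
  by move=> _ _ [A _ <-] [B _ <-]; exists (A `|` B) => //; exact: tauA_join.
Qed.
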